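(* Assume the Continuum Hypothesis. Then there exist countable selectively separable spaces $X$ and $Y$ such that the product $X\times Y$ is not D-separable.
   Context: $X$ is selectively separable if for every sequence $(D_n:n\in\omega)$ of dense subspaces of $X$ one can pick finite sets $F_n\subset D_n$ so that $\bigcup_{n\in\omega}F_n$ is dense in $X$. A subset is discrete if it is discrete in its subspace topology. $X$ is D-separable if for every sequence $(D_n:n\in\omega)$ of dense subspaces of $X$ one can pick discrete sets $F_n\subset D_n$ so that $\bigcup_{n\in\omega}F_n$ is dense in $X$. *)

(* Defs.v *)
From HB Require Import structures.
From mathcomp Require Import all_boot all_order all_algebra.
From mathcomp Require Import all_classical.
From mathcomp Require Import topology.

Set Implicit Arguments.
Unset Strict Implicit.
Unset Printing Implicit Defensive.

Local Open Scope classical_set_scope.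
Local Open Scope card_scope.

(* The continuum is represented by the powerset of nat. *)
Definition continuum_hypothesis : Prop :=
  forall A : set (set nat), countable A \/ A #= [set: set nat].

(* [set_type F] carries the subspace topology of F;
   the library's [subspace F] is instead a topology on all of X. *)
Definition discrete_subset (X : topologicalType) (F : set X) : Prop :=
  forall U : set (set_type F), open U.

Definition selectively_separable (X : topologicalType) : Prop :=
  forall D : nat -> set X, (forall n, dense (D n)) ->
  exists F : nat -> set X,
    (forall n, finite_set (F n) /\ F n `<=` D n) /\
    dense (\bigcup_n F n).

Definition D_separable (X : topologicalType) : Prop :=
  forall D : nat -> set X, (forall n, dense (D n)) ->
  exists F : nat -> set X,
    (forall n, discrete_subset (F n) /\ F n `<=` D n) /\
    dense (\bigcup_n F n).

(* Main.v *)
(* Under CH there is a selective ultrafilter p on nat: every sequence B_m of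
   members of p has a diagonalization A in p, that is, k lies in B_m for all
   m < k in A. Such a p is generated by a tower of length omega_1, decreasing
   modulo finite sets, which decides one sequence at each stage.

   Take X = Y = nat, the nonempty open sets being the members of p; the dense
   sets are then also the members of p. Consider in X * X the dense sets
   D_n = {(m, k) | n <= m < k}. No member of p is discrete, so the vertical
   sections of a discrete set F_n included in D_n are not in p. At most m + 1 of
   the F_n meet the m-th vertical line, so the sections of the union of the F_n
   are not in p either; diagonalizing their complements gives A in p such that
   the open set A * A misses the union. *)
Require Import Defs.
From Stdlib Require Inverse_Image.
From HB Require Import structures.
From mathcomp Require Import all_boot all_order all_algebra.
From mathcomp Require Import all_classical.
From mathcomp Require Import wochoice.
From mathcomp Require Import topology.

Set Implicit Arguments.
Unset Strict Implicit.
Unset Printing Implicit Defensive.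

Local Open Scope classical_set_scope.

(** * Almost inclusion and diagonalization of sets of naturals *)

Section AlmostInclusion.
Implicit Types (A B C : set nat) (G : set (set nat)).

Definition unbounded A := forall n, exists2 k, n <= k & A k.

Definition almost_sub A B := exists n, forall k, n <= k -> A k -> B k.

Lemma almost_sub_refl A : almost_sub A A.
Proof. by exists 0. Qed.

Lemma sub_almost_sub A B : A `<=` B -> almost_sub A B.
Proof. by move=> AB; exists 0 => k _ /AB. Qed.

Lemma almost_sub_trans B A C :
  almost_sub A B -> almost_sub B C -> almost_sub A C.
Proof.
move=> [m AB] [n BC]; exists (maxn m n) => k; rewrite geq_max => /andP[mk nk].
by move=> /(AB _ mk) /(BC _ nk).
Qed.

Lemma almost_subI A B C :
  almost_sub A B -> almost_sub A C -> almost_sub A (B `&` C).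
Proof.
move=> [m AB] [n AC]; exists (maxn m n) => k; rewrite geq_max => /andP[mk nk].
by move=> Ak; split; [exact: AB|exact: AC].
Qed.

Lemma almost_sub_bigcap_ltn A (C : nat -> set nat) n :
  (forall i, i < n -> almost_sub A (C i)) ->
  almost_sub A [set k | forall i, i < n -> C i k].
Proof.
elim: n => [|n IHn] AC; first exact: sub_almost_sub.
have AC' : almost_sub A [set k | forall i, i < n -> C i k].
  by apply: IHn => i /ltnW; exact: AC.
apply: almost_sub_trans (almost_subI AC' (AC n (ltnSn n))) _.
apply: sub_almost_sub => k [Ck Cnk] i.
by rewrite ltnS leq_eqVlt => /orP[/eqP->//|]; exact: Ck.
Qed.

Lemma unbounded_almost_sub A B : unbounded A -> almost_sub A B -> unbounded B.
Proof.
move=> Ainf [m AB] n; have [k] := Ainf (maxn m n).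
by rewrite geq_max => /andP[mk nk] Ak; exists k => //; exact: AB.
Qed.

Lemma not_unboundedD A B : ~ unbounded (A `\` B) -> almost_sub A B.
Proof.
move=> /existsNP[n nAB]; exists n => k nk Ak; apply: contrapT => nBk.
by apply: nAB; exists k.
Qed.

(** The elements of [A] are the iterates from [0] of a map [g] that sends [a] to a larger number
    lying in [C i] for all [i <= a]. *)
Lemma diagonal_intersection (C : nat -> set nat) :
  (forall n, unbounded [set k | forall i, i < n -> C i k]) ->
  exists2 A, unbounded A &
    forall i m k, i <= m -> m < k -> A m -> A k -> C i k.
Proof.
move=> Cinf.
have /choice[g gP] n : exists k, n < k /\ forall i, i <= n -> C i k.
  by have [k nk Ck] := Cinf n.+1 n.+1; exists k.
pose a n := iter n g 0.
have a_lt : {homo a : m n / m < n}.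
  by apply: homo_ltn ltn_trans _ => n; have [] := gP (a n).
have a_mono := leq_mono a_lt.
exists (range a) => [n|i m k im mk [j _ jm] [[|l] _ lk]].
- exists (a n); last by exists n.
  by elim: n => // n IHn; apply: leq_ltn_trans IHn _; exact: a_lt.
- by rewrite -lk in mk.
(* Here [k] is [g (a l)], and [m < k] forces [m <= a l], so [i <= a l]. *)
- have [_ Cg] := gP (a l); rewrite -lk; apply: Cg; apply: leq_trans im _.
  by rewrite -jm a_mono -ltnS -(leqW_mono a_mono) jm lk.
Qed.

(** Finitely many members of [G] have an almost least one, so their intersection is unbounded and
    diagonalization applies. *)
Lemma pseudo_intersection G : countable G ->
  (forall A, G A -> unbounded A) ->
  (forall A B, G A -> G B -> almost_sub A B \/ almost_sub B A) ->
  exists2 C, unbounded C & forall A, G A -> almost_sub C A.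
Proof.
move=> /countable_injP[f finj] Ginf Gtot.
(* [C i] is the member of [G] numbered [i], or all of [nat] when there is none. *)
pose C i := [set k | forall A, G A -> f A = i -> A k].
have GC A : G A -> C (f A) = A.
  move=> GA; apply/seteqP; split=> [k|k Ak B GB]; first by apply.
  by move=> /finj; rewrite !inE => ->.
have CB n : exists2 B, B = setT \/ G B & forall i, i < n -> almost_sub B (C i).
  elim: n => [|n [B GB BC]]; first by exists setT => //; left.
  have CS D : (forall i, i < n -> almost_sub D (C i)) -> almost_sub D (C n) ->
      forall i, i < n.+1 -> almost_sub D (C i).
    by move=> DC DCn i; rewrite ltnS leq_eqVlt => /orP[/eqP->|/DC].
  have [[A [GA fA]]|noA] := pselect (exists A, G A /\ f A = n); last first.
    exists B => //; apply: CS => //; apply: sub_almost_sub => k _ A GA fA.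
    by case: noA; exists A.
  have CnA : C n = A by rewrite -fA GC.
  have [BA|AB] : almost_sub B A \/ almost_sub A B.
    by case: GB => [->|GB]; [right; exact: sub_almost_sub|exact: Gtot].
  - by exists B => //; apply: CS => //; rewrite CnA.
  exists A; first by right.
  apply: CS => [i /BC|]; first exact: almost_sub_trans.
  by rewrite CnA; exact: almost_sub_refl.
have [n|D Dinf DC] := @diagonal_intersection C.
  have [B GB /almost_sub_bigcap_ltn] := CB n; apply: unbounded_almost_sub.
  by case: GB => [->|/Ginf//] m; exists m.
exists D => // A GA; rewrite -(GC _ GA).
have [m fm Dm] := Dinf (f A).
by exists m.+1 => k mk Dk; exact: DC fm mk Dm Dk.
Qed.

(** Either some [B m] is refuted or the sequence is diagonalized. For a constant sequence this
    decides a single set, so one condition yields both the ultrafilter property and selectivity. *)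
Definition selects (B : nat -> set nat) A :=
  (exists m, almost_sub A (~` B m)) \/
  (forall m k, A m -> A k -> m < k -> B m k).

Lemma selects_subset C (B : nat -> set nat) : unbounded C ->
  exists A, [/\ unbounded A, almost_sub A C & selects B A].
Proof.
move=> Cinf.
have [[m CB]|CB] := pselect (exists m, unbounded (C `\` B m)).
  exists (C `\` B m); split=> //; first exact: sub_almost_sub.
  by left; exists m; apply: sub_almost_sub => k [].
have {}CB m : almost_sub C (C `&` B m).
  apply: almost_subI; first exact: almost_sub_refl.
  by apply: not_unboundedD => CBm; apply: CB; exists m.
(* Diagonalizing the traces of the [B i] on [C] keeps [A] almost inside [C]. *)
have [n|A Ainf AC] := @diagonal_intersection (fun i => C `&` B i).
  by apply: unbounded_almost_sub Cinf _; exact: almost_sub_bigcap_ltn.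
exists A; split=> //.
  have [m _ Am] := Ainf 0; exists m.+1 => k mk Ak.
  by have [] := AC _ _ _ (leqnn m) mk Am Ak.
by right=> m k Am Ak mk; have [] := AC _ _ _ (leqnn m) mk Am Ak.
Qed.

End AlmostInclusion.

(** * A well-order with countable initial segments *)

Lemma omega1_order (CH : continuum_hypothesis) :
  exists lt : set nat -> set nat -> Prop,
    [/\ well_founded lt, forall s t, [\/ lt s t, s = t | lt t s] &
        forall t, countable [set s | lt s t]].
Proof.
have [R Rwo] := well_ordering_principle (set nat).
pose lt s t : Prop := ~~ R t s.
have lt_wf : well_founded lt.
  move=> t; apply: contrapT => nt.
  have [|z [[]]] := Rwo [pred s | `[< ~ Acc lt s >]].
    by exists t; apply/asboolP.
  move=> /asboolP nz zmin _; apply: nz; split=> y yz.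
  apply: contrapT => ny; move/negP: yz; apply; apply: zmin.
  exact/asboolP.
(* Unique minima of singletons give reflexivity, those of pairs antisymmetry. *)
have Ranti s t : R s t -> R t s -> s = t.
  move=> st ts.
  have Rss u : R u u.
    have [|z [[zu zmin] _]] := Rwo (pred1 u); first by exists u; exact: eqxx.
    by move: zu (zmin u) => /eqP-> /(_ (eqxx u)).
  have [|z [_ zuniq]] := Rwo (pred2 s t).
    by exists s; rewrite /in_mem/= eqxx.
  apply: etrans (esym (zuniq s _)) (zuniq t _);
    split; rewrite /in_mem/= ?eqxx ?orbT//.
    by move=> u /orP[] /eqP->.
  by move=> u /orP[] /eqP->.
have lt_tot s t : [\/ lt s t, s = t | lt t s].
  have [ts|ts] := boolP (R t s); last by apply: Or31.
  have [st|st] := boolP (R s t); last by apply: Or33.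
  by apply: Or32; exact: Ranti.
have [cseg|/existsNP[t]] := pselect (forall t, countable [set s | lt s t]).
  by exists lt.
elim/(well_founded_ind lt_wf): t => t IHt nt.
have [cseg|/existsNP[s /not_implyP[st]]] :=
  pselect (forall s, lt s t -> countable [set u | lt u s]); last exact: IHt.
(* [t] is least with an uncountable initial segment; by CH this segment is in
   bijection with [set nat], to which its order is transported. *)
have [//|/card_esym/card_set_bijP[f [ft finj _]]] := CH [set s | lt s t].
exists (fun s u => lt (f s) (f u)); split.
- exact: Inverse_Image.wf_inverse_image.
- move=> s u; have [su|su|us] := lt_tot (f s) (f u).
  + exact: Or31.
  + by apply: Or32; apply: finj; rewrite ?inE.
  + exact: Or33.
- move=> s; have /cseg/countable_injP[g ginj] := ft s I.
  apply/countable_injP; exists (g \o f) => u v.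
  rewrite !inE => us vs /= /ginj; rewrite !inE => /(_ us vs).
  by apply: finj; rewrite inE.
Qed.

(** * Construction of a selective ultrafilter *)

Record selective_ultrafilter := SelectiveUltrafilter {
  su_mem :> set nat -> Prop ;
  su_unbounded : forall A, su_mem A -> unbounded A ;
  su_sub : forall A B, A `<=` B -> su_mem A -> su_mem B ;
  su_setI : forall A B, su_mem A -> su_mem B -> su_mem (A `&` B) ;
  su_ultra : forall A, su_mem A \/ su_mem (~` A) ;
  su_diag : forall B : nat -> set nat, (forall m, su_mem (B m)) ->
    exists2 A, su_mem A & forall m k, A m -> A k -> m < k -> B m k
}.

(* Coding sequences by single sets lets the tower be indexed by [set nat], to
   which CH applies. *)
Definition decode_seq (t : set nat) (m : nat) : set nat :=
  [set k | t (pickle (m, k))].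

Lemma decode_seq_surj (B : nat -> set nat) : exists t, decode_seq t = B.
Proof.
exists [set n | exists m k, n = pickle (m, k) /\ B m k].
apply/funext => m; apply/seteqP; split=> [k [m' [k' [+ Bk]]]|k Bk].
  by move=> /(pcan_inj pickleK) [-> ->].
by exists m, k.
Qed.

(** The stages before [t] form a countable chain: take a pseudo-intersection, then shrink it to
    select the sequence coded by [t]. *)
Lemma selective_tower (CH : continuum_hypothesis) :
  exists A : set nat -> set nat,
    [/\ forall t, unbounded (A t),
        forall s t, almost_sub (A s) (A t) \/ almost_sub (A t) (A s) &
        forall t, selects (decode_seq t) (A t)].
Proof.
have [lt [lt_wf lt_tot lt_count]] := @omega1_order CH.
pose next t (rec : forall s, lt s t -> set nat) : set nat :=
  (* The default [set0] is never taken: [AP] shows by induction that a candidate exists. *)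
  xget set0 [set A | [/\ unbounded A, forall s st, almost_sub A (rec s st) &
                         selects (decode_seq t) A]].
pose A := Fix lt_wf (fun=> set nat) next.
have AE t : A t = next t (fun s _ => A s).
  rewrite /A Fix_eq// => u f g fg; congr (next u _).
  by do 2!apply: functional_extensionality_dep => ?; exact: fg.
have AP t : [/\ unbounded (A t), forall s, lt s t -> almost_sub (A t) (A s) &
               selects (decode_seq t) (A t)].
  elim/(well_founded_ind lt_wf): t => t IHt.
  have [|_ [s st <-]|_ _ [s st <-] [u ut <-]|C Cinf CA] :=
    @pseudo_intersection (A @` [set s | lt s t]).
  - exact: card_le_trans (card_image_le _ _) (lt_count t).
  - by have [] := IHt _ st.
  - have [su|->|us] := lt_tot s u.
    + by right; have [_ + _] := IHt _ ut; apply.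
    + by left; exact: almost_sub_refl.
    + by left; have [_ + _] := IHt _ st; apply.
  have [D [Dinf DC Dsel]] := selects_subset (decode_seq t) Cinf.
  rewrite AE /next; case: xgetP => [_ _ []//|/(_ D)[]].
  split=> // s st; apply: almost_sub_trans DC _; apply: CA.
  by exists s.
exists A; split=> [t|s t|t]; try by have [] := AP t.
have [st|->|ts] := lt_tot s t.
- by right; have [_ + _] := AP t; apply.
- by left; exact: almost_sub_refl.
- by left; have [_ + _] := AP s; apply.
Qed.

Lemma selective_ultrafilter_exists (CH : continuum_hypothesis) :
  inhabited selective_ultrafilter.
Proof.
have [A [Ainf Atot Asel]] := selective_tower CH.
pose p := [set B | exists t, almost_sub (A t) B].
have p_inf B : p B -> unbounded B.
  by move=> [t]; exact: unbounded_almost_sub.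
have p_sub B C : B `<=` C -> p B -> p C.
  by move=> BC [t AB]; exists t; apply: almost_sub_trans AB (sub_almost_sub _).
have pI B C : p B -> p C -> p (B `&` C).
  move=> [s AB] [t AC]; have [st|ts] := Atot s t.
    by exists s; apply: almost_subI => //; exact: almost_sub_trans AC.
  by exists t; apply: almost_subI => //; exact: almost_sub_trans AB.
have pA t : p (A t) by exists t; exact: almost_sub_refl.
have p_ultra B : p B \/ p (~` B).
  (* The constant sequence decides [B]: if [A t] diagonalizes it, all elements of [A t] beyond a
     given one lie in [B]. *)
  have [t tB] := decode_seq_surj (fun=> B).
  have := Asel t; rewrite tB => -[[_ AB]|AB]; first by right; exists t.
  left; exists t; have [m _ Am] := Ainf t 0.
  by exists m.+1 => k mk Ak; exact: AB Ak mk.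
apply: inhabits; apply: (@SelectiveUltrafilter p) => // B pB.
have [t tB] := decode_seq_surj B.
have := Asel t; rewrite tB => -[[m AB]|AB]; last by exists (A t).
have /p_inf/(_ 0)[k _ []//] : p (B m `&` ~` B m).
by apply: pI => //; exists t.
Qed.

(** * The space of a selective ultrafilter and its square *)

Definition su_space (p : selective_ultrafilter) : Type := nat.

HB.instance Definition _ p := Choice.on (su_space p).

Section UltrafilterSpace.
Variable p : selective_ultrafilter.
Local Notation X := (su_space p).

Lemma su_nonempty A : p A -> A !=set0.
Proof. by move=> /su_unbounded/(_ 0)[k _ Ak]; exists k. Qed.

Lemma su_setT : p setT.
Proof.
have [//|] := su_ultra p setT.
by rewrite setCT => /su_nonempty[].
Qed.

Lemma su_tail n : p [set k | n <= k].
Proof.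
have [//|/su_unbounded/(_ n)[k nk]] := su_ultra p [set k | n <= k].
by move/(_ nk).
Qed.

Lemma su_bigcap_ltn (B : nat -> set nat) n : (forall i, p (B i)) ->
  p [set k | forall i, i < n -> B i k].
Proof.
move=> pB; elim: n => [|n IHn]; first exact: su_sub su_setT.
apply: su_sub (su_setI IHn (pB n)) => k [Bk Bnk] i.
by rewrite ltnS leq_eqVlt => /orP[/eqP->//|]; exact: Bk.
Qed.

Definition su_open : set (set X) := [set U | U = set0 \/ p U].

Let su_openT : su_open setT.
Proof. by right; exact: su_setT. Qed.

Let su_openI : setI_closed su_open.
Proof.
move=> U V [->|pU] [->|pV]; rewrite ?set0I ?setI0; try by left.
by right; exact: su_setI.
Qed.

Let su_open_bigU (I : Type) (f : I -> set X) :
  (forall i, su_open (f i)) -> su_open (\bigcup_i f i).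
Proof.
move=> fop; have [[i pf]|npf] := pselect (exists i, p (f i)).
  by right; apply: su_sub pf => k fk; exists i.
left; apply/seteqP; split=> // k [i _].
by have [->//|pf] := fop i; case: npf; exists i.
Qed.

HB.instance Definition _ :=
  isOpenTopological.Build X su_openT su_openI su_open_bigU.

Lemma su_space_openE (U : set X) : open U = (U = set0 \/ p U).
Proof. by []. Qed.

(** If [D] is not in [p], its complement is a nonempty open set missing [D]. *)
Lemma su_space_dense (D : set X) : dense D <-> p D.
Proof.
split=> [Dd|pD U [x Ux]]; last first.
  rewrite su_space_openE => -[U0|pU]; first by rewrite U0 in Ux.
  exact/su_nonempty/su_setI.
have [//|pCD] := su_ultra p D.
have [||k []//] := Dd (~` D); first exact: su_nonempty.
by rewrite su_space_openE; right.
Qed.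

Lemma su_space_nbhs (x : X) (U : set X) : nbhs x U -> p U.
Proof.
rewrite nbhsE => -[V [+ Vx] VU]; rewrite su_space_openE => -[V0|].
  by rewrite V0 in Vx.
exact: su_sub.
Qed.

(* If [A] diagonalizes the [D m], the successor in [A] of each [m] in [A] lies
   in [D m]; these successors exhaust [A] but for its minimum. *)
Lemma su_space_selectively_separable : selectively_separable X.
Proof.
move=> D /(_ _)/su_space_dense pD.
have [A pA AD] := su_diag pD.
pose F m := [set k | [/\ A m, A k, m < k & forall j, A j -> m < j -> k <= j]].
exists F; split=> [m|].
  split; last by move=> k [Am Ak mk _]; exact: AD.
  have [->|/set0P[k Fk]] := eqVneq (F m) set0; first exact: finite_set0.
  apply: (@sub_finite_set _ _ [set k]); last exact: finite_set1.
  move=> j; case: Fk => Am Ak mk kmin [_ Aj mj jmin].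
  by apply/eqP; rewrite eqn_leq kmin ?jmin.
apply/su_space_dense; have [a Aa] := su_nonempty pA.
(* Beyond [a], each [k] in [A] has a predecessor in [A], the largest [m] satisfying [P]. *)
apply: su_sub (su_setI pA (su_tail a.+1)) => k [Ak ak].
pose P m := `[< A m >] && (m < k).
have exP : exists m, P m by exists a; apply/andP; split=> //; apply/asboolP.
have Pk m : P m -> m <= k by case/andP=> _ /ltnW.
have [m /andP[/asboolP Am mk] mmax] := ex_maxnP exP Pk.
exists m => //; split=> // j Aj mj; rewrite leqNgt; apply/negP => jk.
have : j <= m by apply: mmax; apply/andP; split=> //; apply/asboolP.
by rewrite leqNgt mj.
Qed.

(** If the section were in [p], every box around a point of [F] on the line would contain further
    points of [F] on it, so that point would not be isolated. *)
Lemma discrete_section (F : set (X * X)) (m : X) :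
  discrete_subset F -> ~ p [set k | F (m, k)].
Proof.
move=> Fd pF; have [k Fk] := su_nonempty pF.
pose x : F := SigSub (mem_set Fk : (m, k) \in F).
have [O Oop Ox] := Fd [set x].
have : O (m, k) by have : (set_val @^-1` O) x by rewrite Ox.
move: Oop; rewrite openE => /[apply] -[[U V] /= [Um Vk] UVO].
have [j kj [Vj Fj]] := su_unbounded (su_setI (su_space_nbhs Vk) pF) k.+1.
pose y : F := SigSub (mem_set Fj : (m, j) \in F).
have : (set_val @^-1` O) y by apply: UVO; split=> //; exact: nbhs_singleton.
rewrite Ox => /(congr1 (fun z : F => (set_val z).2)) /= jk.
by rewrite jk ltnn in kj.
Qed.

Lemma su_space_prod_not_D_separable : ~ D_separable (X * X)%type.
Proof.
pose D n := [set x : X * X | n <= x.1 /\ x.1 < x.2].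
move=> /(_ D)[n O [[a b] Oab]|F [FD Fdense]].
  rewrite openE => /(_ _ Oab)[[U V] /= [Ua Vb] UVO].
  (* Both sides of the box are unbounded, so it contains a point with [n <= j < k]. *)
  have [j nj Uj] := su_unbounded (su_space_nbhs Ua) n.
  have [k jk Vk] := su_unbounded (su_space_nbhs Vb) j.+1.
  by exists (j, k); split=> //; exact: UVO.
(* Only the [F n] with [n <= m] can meet the [m]-th vertical line, whence the bound [m.+1]. *)
pose B m := [set k | forall n, n < m.+1 -> ~ F n (m, k)].
have pB m : p (B m).
  apply: su_bigcap_ltn => n; have [//|] := su_ultra p [set k | ~ F n (m, k)].
  move=> pF; case: (@discrete_section (F n) m); first by have [] := FD n.
  by apply: su_sub pF => k /contrapT.
have [A pA AB] := su_diag pB.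
have [||[j k] [[Aj Ak] [n _ Fjk]]] := Fdense (A `*` A).
- by have [k Ak] := su_nonempty pA; exists (k, k).
- rewrite openE => -[j k] [Aj Ak]; exists (A, A) => //; split;
    by apply: open_nbhs_nbhs; split=> //; rewrite su_space_openE; right.
- have [_ /(_ _ Fjk)[/= nj jk]] := FD n.
  exact: AB Aj Ak jk n nj Fjk.
Qed.

End UltrafilterSpace.

Theorem mainTheorem8 (CH : continuum_hypothesis) :
  exists X Y : topologicalType,
    [/\ countable [set: X], countable [set: Y],
        selectively_separable X, selectively_separable Y
      & ~ D_separable (X * Y)%type].
Proof.
have [p] := selective_ultrafilter_exists CH.
exists (su_space p), (su_space p); split.
- exact: (@countableP nat).
- exact: (@countableP nat).
- exact: su_space_selectively_separable.
- exact: su_space_selectively_separable.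
- exact: su_space_prod_not_D_separable.
Qed.
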